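(* Consider the differential-algebraic power system model described in the context, with all loads purely static (i.e. $Y_{mi}^{\mathrm{eq}}=0$ for all $i\in\mathcal V_L$) and with $x_{di}''=x_{qi}''$ for every generator $i\in\mathcal V_t$ (so that the generator internal voltage $E_i\angle\eta_i$ is a function of the state $\bm x_{gi}$ only and is linked to the terminal bus by the impedance $r_{ai}+\mathrm j x_{di}''$). Suppose that the voltage magnitudes of all buses are non-zero along the system trajectories. If the following conditions are all satisfied: 1) (generator circuit) $G_{gi}\ge0$ and $B_{gi}<0$ for all $i\in\mathcal V_t$; 2) (power network) $G_{ij}=0$ for all $i,j\in\mathcal V_L$; $B_{ij}>0$ for all directly connected $i\ne j$ in $\mathcal V_L$; and $B_{ii}=-\sum_{j=1,j\ne i}^nB_{ij}$ for all $i\in\mathcal V_L$; 3) (active power load) $P_{si}^0=0$ or $\alpha_i=2$, for all $i\in\mathcal V_L$; 4) (reactive power load) $Q_{si}^0\ge0$ and $\beta_i\ge1$, for all $i\in\mathcal V_L$; then the system trajectories never encounter the impasse surface, i.e. $\det\bm J_{\mathrm{alg}}(\bm x(t),\bm y(t))\ne0$ for every trajectory $(\bm x(t),\bm y(t))$ and every time $t$.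
   Context: Notation: $\mathrm j=\sqrt{-1}$; $j$ is an index; $\mathrm{diag}\{x_i\}$ is a diagonal matrix. Buses. Let $1\le g\le n$, $\mathcal V_t=\{1,\dots,g\}$ (generator terminal buses), $\mathcal V_L=\{1,\dots,n\}$ (buses of the power network), $\mathcal V_G=\{n+1,\dots,n+g\}$ (generator internal buses); bus $n+i$ is the internal bus of the generator at terminal bus $i\in\mathcal V_t$. Each bus $i\in\mathcal V_L\cup\mathcal V_G$ has a phase angle $\theta_i$ and a voltage magnitude $V_i\ge 0$; $\theta_{ij}=\theta_i-\theta_j$. Generators. For $i\in\mathcal V_t$ the generator has state $\bm x_{gi}$ obeying $\dot{\bm x}_{gi}=\bm f_{gi}(\bm x_{gi},\theta_i,V_i)$ for a given function $\bm f_{gi}$, armature resistance $r_{ai}$, $d$- and $q$-axis subtransient reactances $x_{di}'',x_{qi}''$. When $x_{di}''=x_{qi}''$ its internal voltage magnitude and angle are given functions of the state only: $V_{n+i}=E_i(\bm x_{gi})$, $\theta_{n+i}=\eta_i(\bm x_{gi})$. Set $y_i^{gs}=(r_{ai}+\mathrm j x_{di}'')^{-1}$. Loads. At bus $i\in\mathcal V_L$ the static load is $P_{si}(V_i)=P_{si}^0V_i^{\alpha_i}$, $Q_{si}(V_i)=Q_{si}^0V_i^{\beta_i}$ with real constants $P_{si}^0,Q_{si}^0,\alpha_i,\beta_i$. In general the model also allows an induction motor at bus $i$, with equivalent admittance $Y_{mi}^{\mathrm{eq}}$; purely static loads means $Y_{mi}^{\mathrm{eq}}=0$ for all $i$, so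 no motor states and no motor consumption appear. Network. Line $(i,j)$ between buses of $\mathcal V_L$ has admittance $y_{ij}=y_{ji}\in\mathbb C$, with $y_{ij}=0$ if $i,j$ are not directly connected; the network on $\mathcal V_L$ is connected; $y_{i0}\in\mathbb C$ is the shunt admittance at bus $i$. $\bm Y_{\mathrm{bus}}=[Y_{ij}]\in\mathbb C^{n\times n}$ has $Y_{ii}=y_{i0}+\sum_{j\ne i}y_{ij}$ and $Y_{ij}=-y_{ij}$ for $i\ne j$; write $Y_{ij}=G_{ij}+\mathrm jB_{ij}$. $\bm Y_{\mathrm{gen}}=\mathrm{diag}\{Y_{gi}\}\in\mathbb C^{n\times n}$ with $Y_{gi}=y_i^{gs}$ for $i\in\mathcal V_t$ and $Y_{gi}=0$ for $i\in\mathcal V_L\setminus\mathcal V_t$; write $Y_{gi}=G_{gi}+\mathrm jB_{gi}$. The augmented admittance matrix is $$\widetilde{\bm Y}=[\widetilde Y_{ij}]=\begin{bmatrix}\bm Y_{\mathrm{bus}}+\bm Y_{\mathrm{gen}}&\bm Y_{LG}\\ \bm Y_{LG}^T&\bm Y_{GG}\end{bmatrix}\in\mathbb C^{(n+g)\times(n+g)},$$ where $\bm Y_{GG}=\mathrm{diag}\{y_i^{gs}\}\in\mathbb C^{g\times g}$, and $\bm Y_{LG}\in\mathbb C^{n\times g}$ has $(i,i)$-entry $-y_i^{gs}$ for $i\in\mathcal V_t$ and all other entries $0$. Write $\widetilde Y_{ij}=\widetilde G_{ij}+\mathrm j\widetilde B_{ij}$. For $i\ne j$ let $\varphi_{ij}$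 be the phase shift with $\widetilde B_{ij}=|\widetilde Y_{ij}|\cos\varphi_{ij}$, $\widetilde G_{ij}=-|\widetilde Y_{ij}|\sin\varphi_{ij}$ (i.e. $\varphi_{ij}=-\tan^{-1}(\widetilde G_{ij}/\widetilde B_{ij})$ when $\widetilde B_{ij}>0$), and $\varphi_{ij}=0$ if $\widetilde Y_{ij}=0$. Power flow equations (purely static loads), for each $i\in\mathcal V_L$: $$0=g_{pi}=V_i^2\widetilde G_{ii}+\sum_{j=1,j\ne i}^{n+g}V_iV_j|\widetilde Y_{ij}|\sin(\theta_{ij}-\varphi_{ij})+P_{si}(V_i),$$ $$0=g_{qi}=-V_i^2\widetilde B_{ii}-\sum_{j=1,j\ne i}^{n+g}V_iV_j|\widetilde Y_{ij}|\cos(\theta_{ij}-\varphi_{ij})+Q_{si}(V_i).$$ DAE system: $\dot{\bm x}=\bm f(\bm x,\bm y)$, $\bm 0=\bm g(\bm x,\bm y)$, where $\bm x$ collects all $\bm x_{gi}$, $\bm y=(\theta_1,\dots,\theta_n,V_1,\dots,V_n)$, $\bm f$ collects the $\bm f_{gi}$, and $\bm g=(g_{p1},\dots,g_{pn},g_{q1},\dots,g_{qn})$, with $\theta_{n+i},V_{n+i}$ substituted by $\eta_i(\bm x_{gi}),E_i(\bm x_{gi})$. A trajectory $(\bm x(t),\bm y(t))$ is a solution of this system; in particular $\bm g(\bm x(t),\bm y(t))=\bm 0$ at every $t$ considered. Algebraic Jacobian: $\bm J_{\mathrm{alg}}(\bm x,\bm y)=\partial\bm g(\bm x,\bm y)/\partial\bm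 y\in\mathbb R^{2n\times2n}$ ($\bm x$ held fixed). Impasse surface: $\{(\bm x,\bm y):\det\bm J_{\mathrm{alg}}(\bm x,\bm y)=0\}$. *)

(* Defs.v *)
From HB Require Import structures.
From mathcomp Require Import all_boot all_order all_algebra.
From mathcomp Require Import all_classical all_reals all_analysis.
From mathcomp Require Import complex.
Set Implicit Arguments.
Unset Strict Implicit.
Unset Printing Implicit Defensive.
Import Order.TTheory GRing.Theory Num.Theory.
Import numFieldNormedType.Exports.
Local Open Scope classical_set_scope.
Local Open Scope ring_scope.
Local Open Scope complex_scope.

(* Buses are 0-based: 'I_n are the network buses, 'I_g numbers the generators,
   and the bus set of the augmented network is 'I_(n + g), in which
   [rshift n k] is the internal bus of generator k.  Only static loads are
   modelled: there are no motor states and no motor consumption. *)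
Record power_system (R : realType) (n g : nat) := PowerSystem {
  gen_gt0 : (0 < g)%N;
  gen_le : (g <= n)%N;

  gen_dim : 'I_g -> nat;
  (* right-hand side of the generator dynamics, as a function of the generator
     state and of the angle and voltage magnitude of its terminal bus *)
  gen_rhs : forall k : 'I_g,
    'rV[R]_(gen_dim k) -> R -> R -> 'rV[R]_(gen_dim k);
  r_a : 'I_g -> R;
  x_d : 'I_g -> R; (* subtransient reactances *)
  x_q : 'I_g -> R;
  (* internal voltage magnitude and angle; that they depend on the generator
     state alone is the modelling consequence of x_d = x_q *)
  E_int : forall k : 'I_g, 'rV[R]_(gen_dim k) -> R;
  eta_int : forall k : 'I_g, 'rV[R]_(gen_dim k) -> R;

  P0 : 'I_n -> R;
  Q0 : 'I_n -> R;
  alpha : 'I_n -> R;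
  beta : 'I_n -> R;

  line : rel 'I_n; (* direct connection *)
  line_irr : irreflexive line;
  line_sym : symmetric line;
  line_conn : forall i j, connect line i j;
  y_line : 'I_n -> 'I_n -> R[i];
  y_line_sym : forall i j, y_line i j = y_line j i;
  y_line_off : forall i j, ~~ line i j -> y_line i j = 0;
  y_shunt : 'I_n -> R[i]
}.

Definition terminal (R : realType) (n g : nat) (sys : power_system R n g)
    (k : 'I_g) : 'I_n :=
  widen_ord (gen_le sys) k.

Definition y_gs (R : realType) (n g : nat) (sys : power_system R n g)
    (k : 'I_g) : R[i] :=
  (r_a sys k +i* x_d sys k)^-1.

Definition Ybus (R : realType) (n g : nat) (sys : power_system R n g) :
    'M[R[i]]_n :=
  \matrix_(i, j) if i == j then y_shunt sys i + \sum_(l < n | l != i) y_line sys i l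
                 else - y_line sys i j.

Definition Ygen (R : realType) (n g : nat) (sys : power_system R n g) :
    'M[R[i]]_n :=
  diag_mx (\row_i if (insub (i : nat) : option 'I_g) is Some k then y_gs sys k
                  else 0).

Definition YLG (R : realType) (n g : nat) (sys : power_system R n g) :
    'M[R[i]]_(n, g) :=
  \matrix_(i, k) if i == terminal sys k then - y_gs sys k else 0.

Definition YGG (R : realType) (n g : nat) (sys : power_system R n g) :
    'M[R[i]]_g :=
  diag_mx (\row_k y_gs sys k).

Definition Yaug (R : realType) (n g : nat) (sys : power_system R n g) :
    'M[R[i]]_(n + g) :=
  block_mx (Ybus sys + Ygen sys) (YLG sys) (YLG sys)^T (YGG sys).

(* This determines phi i j modulo 2 pi, which is all the power flow equations
   depend on. *)
Definition phase_shift (R : realType) (n g : nat) (sys : power_system R n g)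
    (phi : 'I_(n + g) -> 'I_(n + g) -> R) : Prop :=
  forall i j, i != j ->
    [/\ complex.Im (Yaug sys i j) = Normc.normc (Yaug sys i j) * cos (phi i j),
        complex.Re (Yaug sys i j) = - (Normc.normc (Yaug sys i j) * sin (phi i j))
      & Yaug sys i j = 0 -> phi i j = 0].

Definition gen_state (R : realType) (n g : nat) (sys : power_system R n g) :
    Type :=
  forall k : 'I_g, 'rV[R]_(gen_dim sys k).

(* The algebraic variable is the row y = (theta_1 .. theta_n, V_1 .. V_n). *)
Definition bus_angle (R : realType) (n g : nat) (sys : power_system R n g)
    (x : gen_state sys) (y : 'rV[R]_(n + n)) : 'rV[R]_(n + g) :=
  row_mx (lsubmx y) (\row_k eta_int (x k)).

Definition bus_volt (R : realType) (n g : nat) (sys : power_system R n g)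
    (x : gen_state sys) (y : 'rV[R]_(n + n)) : 'rV[R]_(n + g) :=
  row_mx (rsubmx y) (\row_k E_int (x k)).

(* [powR] is the real power for positive bases; at negative bases, which are
   not voltage magnitudes, it takes a default value. *)
Definition P_load (R : realType) (n g : nat) (sys : power_system R n g)
    (i : 'I_n) (v : R) : R :=
  P0 sys i * powR v (alpha sys i).

Definition Q_load (R : realType) (n g : nat) (sys : power_system R n g)
    (i : 'I_n) (v : R) : R :=
  Q0 sys i * powR v (beta sys i).

Definition g_p (R : realType) (n g : nat) (sys : power_system R n g)
    (phi : 'I_(n + g) -> 'I_(n + g) -> R)
    (x : gen_state sys) (y : 'rV[R]_(n + n)) (i : 'I_n) : R :=
  let b := lshift g i in
  let th := bus_angle x y 0 in
  let V := bus_volt x y 0 in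
  V b ^+ 2 * complex.Re (Yaug sys b b)
  + \sum_(j < n + g | j != b)
      V b * V j * Normc.normc (Yaug sys b j) * sin (th b - th j - phi b j)
  + P_load sys i (V b).

Definition g_q (R : realType) (n g : nat) (sys : power_system R n g)
    (phi : 'I_(n + g) -> 'I_(n + g) -> R)
    (x : gen_state sys) (y : 'rV[R]_(n + n)) (i : 'I_n) : R :=
  let b := lshift g i in
  let th := bus_angle x y 0 in
  let V := bus_volt x y 0 in
  - (V b ^+ 2 * complex.Im (Yaug sys b b))
  - \sum_(j < n + g | j != b)
      V b * V j * Normc.normc (Yaug sys b j) * cos (th b - th j - phi b j)
  + Q_load sys i (V b).

Definition g_alg (R : realType) (n g : nat) (sys : power_system R n g)
    (phi : 'I_(n + g) -> 'I_(n + g) -> R)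
    (x : gen_state sys) (y : 'rV[R]_(n + n)) : 'rV[R]_(n + n) :=
  row_mx (\row_i g_p phi x y i) (\row_i g_q phi x y i).

(* [jacobian] acts on row vectors; transposing gives the matrix whose (i, j)
   entry is the derivative of the i-th equation in the j-th variable. *)
Definition J_alg (R : realType) (n g : nat) (sys : power_system R n g)
    (phi : 'I_(n + g) -> 'I_(n + g) -> R)
    (x : gen_state sys) (y : 'rV[R]_(n + n)) : 'M[R]_(n + n) :=
  (jacobian (g_alg phi x) y)^T.

Definition impasse_surface (R : realType) (n g : nat) (sys : power_system R n g)
    (phi : 'I_(n + g) -> 'I_(n + g) -> R) :
    set (gen_state sys * 'rV[R]_(n + n)) :=
  [set xy | \det (J_alg phi xy.1 xy.2) = 0].

(* The time derivative is taken within the time interval T, hence is one-sided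
   at an end point belonging to T. *)
Definition trajectory (R : realType) (n g : nat) (sys : power_system R n g)
    (phi : 'I_(n + g) -> 'I_(n + g) -> R) (T : interval R)
    (x : R -> gen_state sys) (y : R -> 'rV[R]_(n + n)) : Prop :=
  forall t, t \in T ->
    [/\ forall k : 'I_g,
          (s - t)^-1 *: (x s k - x t k) @[s --> within [set` T] t^'] -->
          gen_rhs (x t k) (bus_angle (x t) (y t) 0 (lshift g (terminal sys k)))
                          (bus_volt (x t) (y t) 0 (lshift g (terminal sys k))),
        g_alg phi (x t) (y t) = 0
      & forall j, 0 <= bus_volt (x t) (y t) 0 j].

(* Main.v *)
From HB Require Import structures.
Require Import Defs.
From mathcomp Require Import all_boot all_order all_algebra.
From mathcomp Require Import all_classical all_reals all_analysis.
From mathcomp Require Import complex ring lra.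
Import Order.TTheory GRing.Theory Num.Theory.
Import numFieldNormedType.Exports.
Local Open Scope ring_scope.

(** If the Jacobian is singular at a solution, some nonzero variation v of the
    angles and voltage magnitudes annihilates the differentials of all balance
    equations.  Write a_i for its angle part at bus i and r_i for its relative
    voltage part.  The voltage phasor U_i then varies by U_i (r_i + j a_i),
    whose real and imaginary parts are [phasor_re] and [phasor_im].

    The idea is to read the balance equations as current equations.  The
    complex power at bus i is U_i times the conjugate of the mismatch current
    F_i(U), and F_i vanishes at a solution, so the power equations and the
    current equations have the same kernel there.  The network part of F is
    linear in U with admittance matrix j B, where - B is a graph Laplacian, and
    a load with P0 = 0 or alpha = 2 is a constant conductance.  The imaginary
    part of the Hermitian pairing of W, W_i = U_i (r_i + j a_i), with DF(W)
    therefore contains neither conductances nor active loads.  Its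
    opposite is the sum over the buses of a_i times the differential of the
    active balance plus r_i times that of the reactive balance, and equals
      sum_i Q_i ((beta_i - 1) r_i ^ 2 + a_i ^ 2)
      + sum_i (- B_gi) |W_i| ^ 2 + sum_(lines) B_ik |W_i - W_k| ^ 2
    with Q_i the reactive load at bus i ([energy_identity]; it is proved in real
    coordinates, where the power flow equations are used to eliminate the sums
    of the line flows).

    All terms are nonnegative, hence all vanish when v is in the kernel.  The
    last two sums form the energy of a connected network grounded at the
    terminal of the first generator, so W = 0 ([grounded_form_eq0]), and v = 0
    since the voltages are nonzero. *)

(** * The energy of a grounded network *)

(** The quadratic form of diag(d) plus the Laplacian of the weights w, written
    as it comes out of an admittance matrix: row by row, without symmetrizing
    the sum over pairs. *)
Definition grounded_form {R : realFieldType} {n : nat} (d : 'I_n -> R)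
    (w : 'I_n -> 'I_n -> R) (u : 'I_n -> R) : R :=
  \sum_i d i * u i ^+ 2
  + \sum_i \sum_(j < n | j != i) w i j * (u i ^+ 2 - u i * u j).

(** Adding to the double sum its copy with the two indices swapped turns it into
    a sum of squares. *)
Lemma grounded_formE {R : realFieldType} {n : nat} (d : 'I_n -> R)
    (w : 'I_n -> 'I_n -> R) (u : 'I_n -> R) :
  (forall i j, w i j = w j i) ->
  grounded_form d w u = \sum_i d i * u i ^+ 2
    + 2^-1 * \sum_i \sum_(j < n | j != i) w i j * (u i - u j) ^+ 2.
Proof.
move=> wC; rewrite /grounded_form; congr (_ + _).
set S := LHS.
have S_swap : S = \sum_i \sum_(j < n | j != i) w i j * (u j ^+ 2 - u i * u j).
  rewrite /S [LHS](exchange_big_dep xpredT) //=; apply: eq_bigr => i _.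
  apply: eq_big => [j|j _]; first by rewrite eq_sym.
  by rewrite wC (mulrC (u j)).
have -> : \sum_i \sum_(j < n | j != i) w i j * (u i - u j) ^+ 2 = S + S.
  rewrite {2}S_swap /S -big_split; apply: eq_bigr => i _ /=.
  rewrite -big_split; apply: eq_bigr => j _ /=; ring.
by field.
Qed.

Lemma grounded_form_ge0 {R : realFieldType} {n : nat} (d : 'I_n -> R)
    (w : 'I_n -> 'I_n -> R) (u : 'I_n -> R) :
  (forall i j, w i j = w j i) -> (forall i, 0 <= d i) ->
  (forall i j, j != i -> 0 <= w i j) ->
  0 <= grounded_form d w u.
Proof.
move=> wC d0 w0; rewrite grounded_formE // addr_ge0 //.
  by apply: sumr_ge0 => i _; rewrite mulr_ge0 ?sqr_ge0.
rewrite mulr_ge0 ?invr_ge0 //; apply: sumr_ge0 => i _.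
by apply: sumr_ge0 => j ji; rewrite mulr_ge0 ?sqr_ge0 ?w0.
Qed.

(** Zero energy forces u to be constant along edges, hence constant by
    connectedness, and to vanish at the grounded vertex i0. *)
Lemma grounded_form_eq0 {R : realFieldType} {n : nat} (d : 'I_n -> R)
    (w : 'I_n -> 'I_n -> R) (e : rel 'I_n) (i0 : 'I_n) (u : 'I_n -> R) :
  (forall i j, w i j = w j i) -> (forall i, 0 <= d i) ->
  (forall i j, j != i -> 0 <= w i j) ->
  (forall i j, j != i -> e i j -> 0 < w i j) ->
  (forall i j, connect e i j) -> 0 < d i0 ->
  grounded_form d w u = 0 -> forall i, u i = 0.
Proof.
move=> wC d0 w0 we conn di0; rewrite grounded_formE // => /eqP.
have dge0 i : 0 <= d i * u i ^+ 2 by rewrite mulr_ge0 ?sqr_ge0.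
have wge0 i j : j != i -> 0 <= w i j * (u i - u j) ^+ 2.
  by move=> ji; rewrite mulr_ge0 ?sqr_ge0 ?w0.
have wge0s i : 0 <= \sum_(j < n | j != i) w i j * (u i - u j) ^+ 2.
  by apply: sumr_ge0 => j; exact: wge0.
rewrite paddr_eq0; last 2 first.
- by apply: sumr_ge0 => i _.
- by rewrite mulr_ge0 ?invr_ge0 // sumr_ge0.
rewrite mulf_eq0 invr_eq0 pnatr_eq0 /= => /andP[/eqP d_eq0 /eqP w_eq0].
have ui0 : u i0 = 0.
  move/psumr_eq0P: d_eq0 => /(_ (fun i _ => dge0 i) i0 isT) /eqP.
  by rewrite mulf_eq0 gt_eqF //= sqrf_eq0 => /eqP.
have edge i j : e i j -> u i = u j.
  have [->//|ji eij] := eqVneq j i.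
  move/psumr_eq0P: w_eq0 => /(_ (fun i _ => wge0s i) i isT).
  move/psumr_eq0P => /(_ (wge0 i) j ji) /eqP.
  by rewrite mulf_eq0 gt_eqF ?we //= sqrf_eq0 subr_eq0 => /eqP.
move=> i; rewrite -ui0; case/connectP: (conn i i0) => p + ->.
elim: p i => [//|k p IH] i /= /andP[eik kp].
by rewrite (edge i k eik); exact: IH.
Qed.

(** * Differentials of sums, compositions and rows *)

Lemma is_diff_sum {R : numFieldType} {V W : normedModType R} {I : Type}
    (r : seq I) (P : pred I) {f df : I -> V -> W} {x : V} :
  (forall i, P i -> is_diff x (f i) (df i)) ->
  is_diff x (fun y => \sum_(i <- r | P i) f i y)
    (fun v => \sum_(i <- r | P i) df i v).
Proof.
move=> fdf; elim: r => [|i r IH].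
  rewrite [X in is_diff _ X _](_ : _ = cst 0); last first.
    by apply/funext => y; rewrite big_nil.
  rewrite [X in is_diff _ _ X](_ : _ = 0); last first.
    by apply/funext => y; rewrite big_nil.
  exact: is_diff_cst.
case Pi : (P i); last first.
  under eq_fun do rewrite big_cons Pi.
  by under [X in is_diff _ _ X]eq_fun do rewrite big_cons Pi.
under eq_fun do rewrite big_cons Pi.
under [X in is_diff _ _ X]eq_fun do rewrite big_cons Pi.
exact: (is_diffD (fdf i Pi)).
Qed.

Lemma is_diff_comp_real {R : realFieldType} {V : normedModType R}
    {f df : V -> R} {h : R -> R} {c : R} {x : V} :
  is_diff x f df -> is_derive (f x) 1 h c ->
  is_diff x (fun y => h (f y)) (fun v => df v * c).
Proof.
move=> fdf [dh hc].
have hdh : is_diff (f x) h ( *:%R^~ c).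
  apply: DiffDef; first exact/derivable1_diffP.
  by rewrite deriv1E // derive1E hc.
exact: (is_diff_comp fdf hdh).
Qed.

Lemma is_diff_coord {R : numFieldType} {m : nat} (j : 'I_m) (y : 'rV[R]_m) :
  is_diff y (fun z : 'rV[R]_m => z 0 j) (fun v => v 0 j).
Proof.
pose c (z : 'rV[R]_m) : R := z 0 j.
have c_lin : linear c by move=> k u v; rewrite /c !mxE.
pose cM := GRing.isLinear.Build _ _ _ _ c c_lin.
pose cL : {linear 'rV[R]_m -> R} := HB.pack c cM.
have -> : (fun z : 'rV[R]_m => z 0 j) = cL by [].
apply: DiffDef; first exact/linear_differentiable/coord_continuous.
by rewrite diff_lin //; exact: coord_continuous.
Qed.

(** Reduces a row-valued function to its entries by decomposing it along the
    canonical basis, f y = sum_j f_j(y) e_j. *)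
Lemma is_diff_row {R : numFieldType} {V : normedModType R} {m : nat}
    {f : V -> 'rV[R]_m} {df : 'I_m -> V -> R} {x : V} :
  (forall j, is_diff x (fun y => f y 0 j) (df j)) ->
  is_diff x f (fun v => \row_j df j v).
Proof.
move=> fdf.
rewrite [X in is_diff _ X _](_ : _ =
    (fun y => \sum_j f y 0 j *: 'e_j)); last first.
  by apply/funext => y; exact: row_sum_delta.
rewrite [X in is_diff _ _ X](_ : _ =
    (fun v => \sum_j df j v *: 'e_j)); last first.
  by apply/funext => v; rewrite [LHS]row_sum_delta; apply: eq_bigr => j _;
    rewrite mxE.
apply: is_diff_sum => j _; have [fj dfj] := fdf j.
apply: DiffDef; first exact: differentiableZl.
by rewrite diffZl // dfj.
Qed.

(** * Differentials of the balance equations *)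

Section augmented_network.
Context {R : realType} {n g : nat} (sys : power_system R n g).
Context (phi : 'I_(n + g) -> 'I_(n + g) -> R) (x : gen_state sys).
Implicit Types (y v : 'rV[R]_(n + n)) (i : 'I_n) (b j : 'I_(n + g)).

(** The internal angles and voltages are functions of the generator state, which
    is held fixed, so their variations are zero. *)
Definition angle_var v : 'rV[R]_(n + g) := row_mx (lsubmx v) 0.
Definition volt_var v : 'rV[R]_(n + g) := row_mx (rsubmx v) 0.

Lemma is_diff_bus_angle y b :
  is_diff y (fun z => bus_angle x z 0 b) (fun v => angle_var v 0 b).
Proof.
rewrite /bus_angle /angle_var; case: (splitP b) => [i|k] bE.
  have -> : b = lshift g i by exact: val_inj.
  under eq_fun do rewrite row_mxEl mxE.
  under [X in is_diff _ _ X]eq_fun do rewrite row_mxEl mxE.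
  exact: is_diff_coord.
have -> : b = rshift n k by exact: val_inj.
under eq_fun do rewrite row_mxEr.
under [X in is_diff _ _ X]eq_fun do rewrite row_mxEr mxE.
exact: is_diff_cst.
Qed.

Lemma is_diff_bus_volt y b :
  is_diff y (fun z => bus_volt x z 0 b) (fun v => volt_var v 0 b).
Proof.
rewrite /bus_volt /volt_var; case: (splitP b) => [i|k] bE.
  have -> : b = lshift g i by exact: val_inj.
  under eq_fun do rewrite row_mxEl mxE.
  under [X in is_diff _ _ X]eq_fun do rewrite row_mxEl mxE.
  exact: is_diff_coord.
have -> : b = rshift n k by exact: val_inj.
under eq_fun do rewrite row_mxEr.
under [X in is_diff _ _ X]eq_fun do rewrite row_mxEr mxE.
exact: is_diff_cst.
Qed.

(** One term of the sums over the other buses in the balance equations.  The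
    derivative of an active flow in the angle difference is the reactive flow,
    and that of a reactive flow is minus the active flow. *)
Definition active_flow y b j : R :=
  let th := bus_angle x y 0 in let V := bus_volt x y 0 in
  V b * V j * Normc.normc (Yaug sys b j) * sin (th b - th j - phi b j).

Definition reactive_flow y b j : R :=
  let th := bus_angle x y 0 in let V := bus_volt x y 0 in
  V b * V j * Normc.normc (Yaug sys b j) * cos (th b - th j - phi b j).

(** In terms of relative variations, differentiating a monomial in the voltages
    multiplies it by its degree, so that the differentials below are linear
    combinations of the flows and loads themselves. *)
Definition rel_volt_var y v b : R := volt_var v 0 b / bus_volt x y 0 b.

Lemma is_diff_flow_angle y b j :
  is_diff y (fun z => bus_angle x z 0 b - bus_angle x z 0 j - phi b j)
    (fun v => angle_var v 0 b - angle_var v 0 j).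
Proof.
have db := is_diff_bus_angle y b; have dj := is_diff_bus_angle y j.
apply: (is_diff_eq (is_diffB (is_diffB db dj) (is_diff_cst (phi b j) y))).
by rewrite subr0.
Qed.

Lemma is_diff_volt_prod y b j : (forall l, bus_volt x y 0 l != 0) ->
  is_diff y (fun z => bus_volt x z 0 b * bus_volt x z 0 j)
    (fun v => bus_volt x y 0 b * bus_volt x y 0 j *
              (rel_volt_var y v b + rel_volt_var y v j)).
Proof.
move=> V0; have db := is_diff_bus_volt y b; have dj := is_diff_bus_volt y j.
apply: (is_diff_eq (is_diffM db dj)); apply/funext => v.
by rewrite /rel_volt_var !fctE /GRing.scale /=; field; rewrite !V0.
Qed.

Lemma is_diff_active_flow y b j : (forall l, bus_volt x y 0 l != 0) ->
  is_diff y (fun z => active_flow z b j)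
    (fun v => (rel_volt_var y v b + rel_volt_var y v j) * active_flow y b j
            + (angle_var v 0 b - angle_var v 0 j) * reactive_flow y b j).
Proof.
move=> V0; rewrite /active_flow.
have dV := is_diff_volt_prod y b j V0.
have dS := is_diff_comp_real (is_diff_flow_angle y b j)
  (is_derive_sin _).
have dC : is_diff y (cst (Normc.normc (Yaug sys b j))) (fun=> 0) :=
  is_diff_cst _ y.
apply: (is_diff_eq (is_diffM (is_diffM dV dC) dS)); apply/funext => v.
by rewrite /reactive_flow !fctE /GRing.scale /=; ring.
Qed.

Lemma is_diff_reactive_flow y b j : (forall l, bus_volt x y 0 l != 0) ->
  is_diff y (fun z => reactive_flow z b j)
    (fun v => (rel_volt_var y v b + rel_volt_var y v j) * reactive_flow y b j
            - (angle_var v 0 b - angle_var v 0 j) * active_flow y b j).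
Proof.
move=> V0; rewrite /reactive_flow.
have dV := is_diff_volt_prod y b j V0.
have dS := is_diff_comp_real (is_diff_flow_angle y b j)
  (is_derive_cos _).
have dC : is_diff y (cst (Normc.normc (Yaug sys b j))) (fun=> 0) :=
  is_diff_cst _ y.
apply: (is_diff_eq (is_diffM (is_diffM dV dC) dS)); apply/funext => v.
by rewrite /active_flow !fctE /GRing.scale /=; ring.
Qed.

Lemma is_diff_load y b (k a : R) : 0 < bus_volt x y 0 b ->
  is_diff y (fun z => k * bus_volt x z 0 b `^ a)
    (fun v => a * (k * bus_volt x y 0 b `^ a) * rel_volt_var y v b).
Proof.
move=> V0; have dV := is_diff_bus_volt y b.
have dp := is_diff_comp_real dV (is_derive1_powR a V0).
have dk : is_diff y (cst k) (fun=> 0) := is_diff_cst _ y.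
apply: (is_diff_eq (is_diffM dk dp)); apply/funext => v.
rewrite !fctE /GRing.scale /= mulr0 addr0 /rel_volt_var.
have -> : bus_volt x y 0 b `^ (a - 1)
    = bus_volt x y 0 b `^ a / bus_volt x y 0 b.
  rewrite powRB; last by rewrite (gt_eqF V0) implybT.
  by rewrite powRr1 // ltW.
by field; rewrite gt_eqF.
Qed.

Lemma is_diff_volt_sqr y b : (forall l, bus_volt x y 0 l != 0) ->
  is_diff y (fun z => bus_volt x z 0 b ^+ 2)
    (fun v => 2 * rel_volt_var y v b * bus_volt x y 0 b ^+ 2).
Proof.
move=> V0; under eq_fun do rewrite expr2.
apply: (is_diff_eq (is_diff_volt_prod y b b V0)).
by apply/funext => v; ring.
Qed.

Definition g_p_var y v i : R :=
  let b := lshift g i in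
  2 * rel_volt_var y v b * (bus_volt x y 0 b ^+ 2 * complex.Re (Yaug sys b b))
  + \sum_(j < n + g | j != b)
      ((rel_volt_var y v b + rel_volt_var y v j) * active_flow y b j
       + (angle_var v 0 b - angle_var v 0 j) * reactive_flow y b j)
  + alpha sys i * P_load sys i (bus_volt x y 0 b) * rel_volt_var y v b.

Definition g_q_var y v i : R :=
  let b := lshift g i in
  - (2 * rel_volt_var y v b
     * (bus_volt x y 0 b ^+ 2 * complex.Im (Yaug sys b b)))
  - \sum_(j < n + g | j != b)
      ((rel_volt_var y v b + rel_volt_var y v j) * reactive_flow y b j
       - (angle_var v 0 b - angle_var v 0 j) * active_flow y b j)
  + beta sys i * Q_load sys i (bus_volt x y 0 b) * rel_volt_var y v b.

Lemma is_diff_g_p y i : (forall l, bus_volt x y 0 l != 0) ->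
  0 < bus_volt x y 0 (lshift g i) ->
  is_diff y (fun z => g_p phi x z i) (fun v => g_p_var y v i).
Proof.
move=> V0 Vi0.
have dG : is_diff y (cst (complex.Re (Yaug sys (lshift g i) (lshift g i))))
  (fun=> 0) := is_diff_cst _ y.
have dV := is_diff_volt_sqr y (lshift g i) V0.
have dS := is_diff_sum (index_enum 'I_(n + g)) (fun j => j != lshift g i)
  (fun j _ => is_diff_active_flow y (lshift g i) j V0).
have dP := is_diff_load y (lshift g i) (P0 sys i) (alpha sys i) Vi0.
apply: (is_diff_eq (is_diffD (is_diffD (is_diffM dV dG) dS) dP)).
apply/funext => v; rewrite /g_p_var /P_load !fctE /GRing.scale /=.
by ring.
Qed.

Lemma is_diff_g_q y i : (forall l, bus_volt x y 0 l != 0) ->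
  0 < bus_volt x y 0 (lshift g i) ->
  is_diff y (fun z => g_q phi x z i) (fun v => g_q_var y v i).
Proof.
move=> V0 Vi0.
have dB : is_diff y (cst (complex.Im (Yaug sys (lshift g i) (lshift g i))))
  (fun=> 0) := is_diff_cst _ y.
have dV := is_diff_volt_sqr y (lshift g i) V0.
have dS := is_diff_sum (index_enum 'I_(n + g)) (fun j => j != lshift g i)
  (fun j _ => is_diff_reactive_flow y (lshift g i) j V0).
have dQ := is_diff_load y (lshift g i) (Q0 sys i) (beta sys i) Vi0.
apply: (is_diff_eq (is_diffD (is_diffB (is_diffN (is_diffM dV dB)) dS) dQ)).
apply/funext => v; rewrite /g_q_var /Q_load !fctE /GRing.scale /=.
by ring.
Qed.

Lemma is_diff_g_alg y : (forall l, bus_volt x y 0 l != 0) ->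
  (forall i, 0 < bus_volt x y 0 (lshift g i)) ->
  is_diff y (g_alg phi x)
    (fun v => row_mx (\row_i g_p_var y v i) (\row_i g_q_var y v i)).
Proof.
move=> V0 Vi0.
rewrite [X in is_diff _ _ X](_ : _ = fun v => \row_j
    row_mx (\row_i g_p_var y v i) (\row_i g_q_var y v i) 0 j); last first.
  by apply/funext => v; apply/rowP => j; rewrite [RHS]mxE.
apply: is_diff_row => j; rewrite /g_alg; case: (splitP j) => i jE.
  have -> : j = lshift n i by exact: val_inj.
  under eq_fun do rewrite row_mxEl mxE.
  under [X in is_diff _ _ X]eq_fun do rewrite row_mxEl mxE.
  exact: is_diff_g_p.
have -> : j = rshift n i by exact: val_inj.
under eq_fun do rewrite row_mxEr mxE.
under [X in is_diff _ _ X]eq_fun do rewrite row_mxEr mxE.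
exact: is_diff_g_q.
Qed.

(** [jacobian] multiplies row vectors from the right, so a left null vector of
    it is a direction in which the differential vanishes. *)
Lemma J_alg_kernel y : (forall l, bus_volt x y 0 l != 0) ->
  (forall i, 0 < bus_volt x y 0 (lshift g i)) ->
  \det (J_alg phi x y) = 0 ->
  exists2 v, v != 0 & forall i, g_p_var y v i = 0 /\ g_q_var y v i = 0.
Proof.
move=> V0 Vi0; rewrite /J_alg det_tr => /eqP /det0P [v v0 vJ]; exists v => //.
have [dg dgE] := is_diff_g_alg y V0 Vi0.
move: vJ; rewrite -deriveEjacobian // deriveE // dgE => /rowP vJ i; split.
  by move: (vJ (lshift n i)); rewrite row_mxEl !mxE.
by move: (vJ (rshift n i)); rewrite row_mxEr !mxE.
Qed.

(** * The energy identity *)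

(** The power flow equations express the sums of the active and reactive flows
    out of the bus through its self-admittance and its load.  After this
    substitution, the conductance of the bus and its active load enter th_b
    times the first differential and r_b times the second with opposite
    coefficients, provided that the load differentiates like a quadratic
    function of the voltage.  The sum that is left pairs the variations of the
    two ends of each branch, so that its terms for the internal buses vanish. *)
Lemma balance_form y v i : g_alg phi x y = 0 ->
  P0 sys i = 0 \/ alpha sys i = 2 ->
  let b := lshift g i in
  let th := angle_var v 0 in let r := rel_volt_var y v in
  let Q := Q_load sys i (bus_volt x y 0 b) in
  th b * g_p_var y v i + r b * g_q_var y v i =
    Q * ((beta sys i - 1) * r b ^+ 2 + th b ^+ 2)
    - complex.Im (Yaug sys b b)
      * (bus_volt x y 0 b ^+ 2 * (th b ^+ 2 + r b ^+ 2))
    + \sum_(j < n + g | j != b)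
        ((th b * r j - th j * r b) * active_flow y b j
         - (th b * th j + r b * r j) * reactive_flow y b j).
Proof.
move=> g0 hP b th r Q.
have gp0 : g_p phi x y i = 0.
  by move/rowP: g0 => /(_ (lshift n i)); rewrite /g_alg row_mxEl !mxE.
have gq0 : g_q phi x y i = 0.
  by move/rowP: g0 => /(_ (rshift n i)); rewrite /g_alg row_mxEr !mxE.
have hP2 : alpha sys i * P_load sys i (bus_volt x y 0 b)
    = 2 * P_load sys i (bus_volt x y 0 b).
  by case: hP => [P00|->//]; rewrite /P_load P00 !mul0r !mulr0.
rewrite /g_p_var /g_q_var -/b -/th -/r -/Q hP2.
set G := _ * complex.Re _; set B := _ * complex.Im _.
set P := P_load _ _ _.
pose sp := \sum_(j < n + g | j != b) active_flow y b j.
pose sq := \sum_(j < n + g | j != b) reactive_flow y b j.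
have {}gp0 : G + sp + P = 0 by [].
have {}gq0 : - B - sq + Q = 0 by [].
pose sr_p := \sum_(j < n + g | j != b) r j * active_flow y b j.
pose sr_q := \sum_(j < n + g | j != b) r j * reactive_flow y b j.
pose st_p := \sum_(j < n + g | j != b) th j * active_flow y b j.
pose st_q := \sum_(j < n + g | j != b) th j * reactive_flow y b j.
have -> : \sum_(j < n + g | j != b)
    ((r b + r j) * active_flow y b j + (th b - th j) * reactive_flow y b j)
    = r b * sp + sr_p + (th b * sq - st_q).
  rewrite !mulr_sumr -sumrB -!big_split /=; apply: eq_bigr => j _; ring.
have -> : \sum_(j < n + g | j != b)
    ((r b + r j) * reactive_flow y b j - (th b - th j) * active_flow y b j)
    = r b * sq + sr_q - (th b * sp - st_p).
  rewrite !mulr_sumr -!sumrB -!big_split -sumrB /=.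
  by apply: eq_bigr => j _; ring.
have -> : \sum_(j < n + g | j != b)
    ((th b * r j - th j * r b) * active_flow y b j
     - (th b * th j + r b * r j) * reactive_flow y b j)
    = th b * sr_p - r b * st_p - (th b * st_q + r b * sr_q).
  rewrite !mulr_sumr -!sumrB -!big_split -sumrB /=.
  by apply: eq_bigr => j _; ring.
have -> : sp = - G - P by lra.
have -> : sq = Q - B by lra.
rewrite /B; ring.
Qed.

(** Real and imaginary parts of the variation V e^(j theta) (r + j a) of the
    voltage phasor.  Only in these coordinates is the network part of the form
    independent of the operating point. *)
Definition phasor_re y v i : R :=
  let b := lshift g i in
  bus_volt x y 0 b * (rel_volt_var y v b * cos (bus_angle x y 0 b)
                      - angle_var v 0 b * sin (bus_angle x y 0 b)).

Definition phasor_im y v i : R :=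
  let b := lshift g i in
  bus_volt x y 0 b * (rel_volt_var y v b * sin (bus_angle x y 0 b)
                      + angle_var v 0 b * cos (bus_angle x y 0 b)).

Lemma phasor_sqr y v i : let b := lshift g i in
  phasor_re y v i ^+ 2 + phasor_im y v i ^+ 2 =
  bus_volt x y 0 b ^+ 2 * (angle_var v 0 b ^+ 2 + rel_volt_var y v b ^+ 2).
Proof.
move=> b; rewrite /phasor_re /phasor_im -/b.
have := cos2Dsin2 (bus_angle x y 0 b).
move: (cos _) (sin _) => c s cs.
rewrite -[RHS]mulr1 -cs; ring.
Qed.

Lemma phasor_eq0 y v i : let b := lshift g i in bus_volt x y 0 b != 0 ->
  phasor_re y v i = 0 -> phasor_im y v i = 0 ->
  v 0 (lshift n i) = 0 /\ v 0 (rshift n i) = 0.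
Proof.
move=> b Vb re0 im0; have /eqP := phasor_sqr y v i.
rewrite re0 im0 expr0n addr0 eq_sym mulf_eq0 sqrf_eq0 (negbTE Vb) /=.
rewrite paddr_eq0 ?sqr_ge0 // !sqrf_eq0 /rel_volt_var mulf_eq0 invr_eq0.
rewrite -/b (negbTE Vb) orbF /angle_var /volt_var !row_mxEl !mxE.
by move=> /andP[/eqP -> /eqP ->].
Qed.

Lemma Yaug_diag i :
  complex.Im (Yaug sys (lshift g i) (lshift g i)) =
  complex.Im (Ybus sys i i) + complex.Im (Ygen sys i i).
Proof.
by rewrite /Yaug block_mxEul mxE; case: (Ybus sys i i); case: (Ygen sys i i).
Qed.

Lemma Yaug_off i k : i != k ->
  Yaug sys (lshift g i) (lshift g k) = Ybus sys i k.
Proof.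
by move=> ik; rewrite /Yaug block_mxEul /Ygen !mxE (negbTE ik) mulr0n addr0.
Qed.

(** A purely susceptive line has a phase shift with zero sine. *)
Lemma network_flow y i k : phase_shift sys phi -> i != k ->
  complex.Re (Ybus sys i k) = 0 ->
  let b := lshift g i in let l := lshift g k in
  let th := bus_angle x y 0 in let V := bus_volt x y 0 in
  active_flow y b l
    = V b * V l * complex.Im (Ybus sys i k) * sin (th b - th l) /\
  reactive_flow y b l
    = V b * V l * complex.Im (Ybus sys i k) * cos (th b - th l).
Proof.
move=> hphi ik G0 b l th V.
have bl : b != l by rewrite eq_lshift.
have [Bc Gs _] := hphi b l bl.
move: Bc Gs; rewrite Yaug_off // G0 -(Yaug_off i k ik) -/b -/l => -> /eqP.
rewrite eq_sym oppr_eq0 => /eqP Gs.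
rewrite /active_flow /reactive_flow -/th -/V.
rewrite (sinB (th b - th l)) (cosB (th b - th l)).
set N := Normc.normc _ in Gs *; split.
  transitivity (V b * V l * N * cos (phi b l) * sin (th b - th l)
    - V b * V l * cos (th b - th l) * (N * sin (phi b l))); first ring.
  by rewrite Gs; ring.
transitivity (V b * V l * N * cos (phi b l) * cos (th b - th l)
    + V b * V l * sin (th b - th l) * (N * sin (phi b l))); first ring.
by rewrite Gs; ring.
Qed.

(** The last factor is the real part of conj(W_i) W_k for the phasor
    variations W. *)
Lemma network_term y v i k : phase_shift sys phi -> i != k ->
  complex.Re (Ybus sys i k) = 0 ->
  let b := lshift g i in let l := lshift g k in
  let th := angle_var v 0 in let r := rel_volt_var y v in
  (th b * r l - th l * r b) * active_flow y b l
    - (th b * th l + r b * r l) * reactive_flow y b l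
  = - (complex.Im (Ybus sys i k)
       * (phasor_re y v i * phasor_re y v k
          + phasor_im y v i * phasor_im y v k)).
Proof.
move=> hphi ik G0 b l th r; have [-> ->] := network_flow y i k hphi ik G0.
rewrite /phasor_re /phasor_im sinB cosB -/b -/l -/th -/r; ring.
Qed.

(** The diagonal of the bus matrix being minus its off-diagonal row sums, the
    pairings of [network_term] complete to Laplacian terms, separately for the
    real and the imaginary parts; the generator susceptances ground them. *)
Lemma energy_identity y v : phase_shift sys phi ->
  (forall i k, complex.Re (Ybus sys i k) = 0) ->
  (forall i, complex.Im (Ybus sys i i)
             = - \sum_(k < n | k != i) complex.Im (Ybus sys i k)) ->
  (forall i, P0 sys i = 0 \/ alpha sys i = 2) ->
  g_alg phi x y = 0 ->
  let d i := - complex.Im (Ygen sys i i) in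
  let w i k := complex.Im (Ybus sys i k) in
  \sum_i (angle_var v 0 (lshift g i) * g_p_var y v i
          + rel_volt_var y v (lshift g i) * g_q_var y v i)
  = \sum_i Q_load sys i (bus_volt x y 0 (lshift g i))
          * ((beta sys i - 1) * rel_volt_var y v (lshift g i) ^+ 2
             + angle_var v 0 (lshift g i) ^+ 2)
    + (grounded_form d w (phasor_re y v)
       + grounded_form d w (phasor_im y v)).
Proof.
move=> hphi hG hB hP g0 d w.
rewrite /grounded_form addrACA -!big_split /=; apply: eq_bigr => i _.
rewrite balance_form // -phasor_sqr Yaug_diag hB -/(d i).
(* The internal buses contribute nothing, their variations being zero. *)
rewrite big_split_ord /= [X in _ + (_ + X) = _]big1 ?addr0; last first.
  move=> k _; rewrite /rel_volt_var /angle_var /volt_var !row_mxEr !mxE.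
  by rewrite !(mul0r, mulr0) !subr0 addr0 !mul0r subr0.
have -> : \sum_(k < n | lshift g k != lshift g i)
     ((angle_var v 0 (lshift g i) * rel_volt_var y v (lshift g k)
       - angle_var v 0 (lshift g k) * rel_volt_var y v (lshift g i))
      * active_flow y (lshift g i) (lshift g k)
      - (angle_var v 0 (lshift g i) * angle_var v 0 (lshift g k)
         + rel_volt_var y v (lshift g i) * rel_volt_var y v (lshift g k))
      * reactive_flow y (lshift g i) (lshift g k))
  = - \sum_(k < n | k != i) w i k * (phasor_re y v i * phasor_re y v k
                                    + phasor_im y v i * phasor_im y v k).
  rewrite -sumrN; apply: eq_big => [k|k]; rewrite eq_lshift // => ki.
  by rewrite network_term // eq_sym.
have expand u : \sum_(k < n | k != i) w i k * (u i ^+ 2 - u i * u k)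
    = u i ^+ 2 * (\sum_(k < n | k != i) w i k)
      - \sum_(k < n | k != i) w i k * (u i * u k).
  by rewrite mulr_sumr -sumrB; apply: eq_bigr => k _; ring.
rewrite !expand.
have -> : \sum_(k < n | k != i) w i k * (phasor_re y v i * phasor_re y v k
                                    + phasor_im y v i * phasor_im y v k)
  = \sum_(k < n | k != i) w i k * (phasor_re y v i * phasor_re y v k)
    + \sum_(k < n | k != i) w i k * (phasor_im y v i * phasor_im y v k).
  by rewrite -big_split; apply: eq_bigr => k _ /=; ring.
rewrite -/(w i) /d; ring.
Qed.

End augmented_network.

(** * Nonsingularity along trajectories *)

Theorem theorem2 (R : realType) (n g : nat) (sys : power_system R n g)
  (phi : 'I_(n + g) -> 'I_(n + g) -> R) (hphi : phase_shift sys phi)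
  (hxdq : forall k : 'I_g, x_d sys k = x_q sys k)
  (hgen : forall i : 'I_n, (i < g)%N ->
     0 <= complex.Re (Ygen sys i i) /\ complex.Im (Ygen sys i i) < 0)
  (hG : forall i j : 'I_n, complex.Re (Ybus sys i j) = 0)
  (hB : forall i j : 'I_n, i != j -> line sys i j ->
     0 < complex.Im (Ybus sys i j))
  (hBdiag : forall i : 'I_n,
     complex.Im (Ybus sys i i) = - \sum_(j < n | j != i) complex.Im (Ybus sys i j))
  (hP : forall i : 'I_n, P0 sys i = 0 \/ alpha sys i = 2)
  (hQ : forall i : 'I_n, 0 <= Q0 sys i /\ 1 <= beta sys i)
  (T : interval R) (x : R -> gen_state sys) (y : R -> 'rV[R]_(n + n))
  (htraj : trajectory phi T x y)
  (hV : forall t, t \in T -> forall j, bus_volt (x t) (y t) 0 j != 0) :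
  forall t, t \in T -> ~ impasse_surface phi (x t, y t).
Proof.
move=> t tT; rewrite /impasse_surface /= => detJ.
have [_ g0 Vge0] := htraj t tT; have V0 := hV t tT.
have Vgt0 i : 0 < bus_volt (x t) (y t) 0 (lshift g i).
  by rewrite lt_neqAle eq_sym V0 Vge0.
have [v /negP v0 vJ] := J_alg_kernel sys phi (x t) (y t) V0 Vgt0 detJ.
apply: v0.
pose d i := - complex.Im (Ygen sys i i).
pose w i k := complex.Im (Ybus sys i k).
have wC i k : w i k = w k i.
  by rewrite /w /Ybus !mxE eq_sym; case: eqP => [->|_]; rewrite // y_line_sym.
have w_line i k : k != i -> line sys i k -> 0 < w i k.
  by rewrite eq_sym; exact: hB.
have w0 i k : k != i -> 0 <= w i k.
  move=> ki; have [/(w_line i k ki)/ltW//|lik] := boolP (line sys i k).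
  by rewrite /w /Ybus mxE eq_sym (negbTE ki) y_line_off // oppr0.
have d0 i : 0 <= d i.
  rewrite oppr_ge0; case: (ltnP i g) => ig; first by have [_ /ltW] := hgen i ig.
  by rewrite /Ygen !mxE eqxx insubF // ltnNge ig.
pose i0 := terminal sys (Ordinal (gen_gt0 sys)).
have di0 : 0 < d i0 by rewrite oppr_gt0; apply: (hgen i0 (gen_gt0 sys)).2.
have := energy_identity sys phi (x t) (y t) v hphi hG hBdiag hP g0.
rewrite -/d -/w big1 => [/esym /eqP|i _]; last first.
  by have [-> ->] := vJ i; rewrite !mulr0 addr0.
have ge0 u := grounded_form_ge0 d w u wC d0 w0.
rewrite paddr_eq0; last 2 first.
- apply: sumr_ge0 => i _; have [Qi bi] := hQ i.
  rewrite mulr_ge0 // ?addr_ge0 ?sqr_ge0 //.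
    by rewrite mulr_ge0 // powR_ge0.
  by rewrite mulr_ge0 ?sqr_ge0 // subr_ge0.
- by rewrite addr_ge0.
rewrite paddr_eq0 // => /and3P[_ /eqP re0 /eqP im0].
have eq0 u := grounded_form_eq0 d w (line sys) i0 u wC d0 w0 w_line
  (line_conn sys) di0.
apply/eqP/rowP => j; rewrite [RHS]mxE.
have vi0 i := phasor_eq0 sys (x t) (y t) v i (V0 _) (eq0 _ re0 i) (eq0 _ im0 i).
case: (splitP j) => i jE.
  by have -> : j = lshift n i by [exact: val_inj]; have [] := vi0 i.
by have -> : j = rshift n i by [exact: val_inj]; have [] := vi0 i.
Qed.
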